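(* Let $A,B$ be positive definite matrices and $-1\le t\le-\tfrac12$. Then \[ A\,\widehat{sp}_t\,B\prec_{\log}\left(A^{1-t}B^{2t}A^{1-t}\right)^{1/2}. \]
   Context: For positive definite matrices $A,B$ and $t\in\mathbb{R}$: $A\sharp B:=A^{1/2}(A^{-1/2}BA^{-1/2})^{1/2}A^{1/2}$ and $A\,\widehat{sp}_t\,B:=(A^{-1}\sharp B)^tA(A^{-1}\sharp B)^t$. For $n\times n$ positive semidefinite matrices $X,Y$ with eigenvalues $\lambda_1(\cdot)\ge\dots\ge\lambda_n(\cdot)$, $X\prec_{\log}Y$ means $\prod_{j=1}^k\lambda_j(X)\le\prod_{j=1}^k\lambda_j(Y)$ for $k=1,\dots,n-1$ and $\det X=\det Y$. *)

(* Defs.v *)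
(* matrices over the complex numbers R[i] (R : realType),
   spectral theory from mathcomp/algebra/spectral.v, real powers powR from
   mathcomp-analysis. *)
From HB Require Import structures.
From mathcomp Require Import all_boot all_order all_algebra.
From mathcomp Require Import sesquilinear spectral.
From mathcomp Require Import complex.
From mathcomp Require Import reals exp.
Set Implicit Arguments.
Unset Strict Implicit.
Unset Printing Implicit Defensive.
Import Order.TTheory GRing.Theory Num.Theory.
Local Open Scope ring_scope.
Local Open Scope sesquilinear_scope.

Section Defs.
Variable R : realType.
Local Notation C := (R[i]).

(* positive definite: Hermitian and x A x^* > 0 for every nonzero (row) vector x *)
Definition posdef n (A : 'M[C]_n) : Prop :=
  A \is hermsymmx /\ forall x : 'rV[C]_n, x != 0 -> 0 < (x *m A *m x ^t*) 0 0.

(* real power A^t of a positive definite matrix, by functional calculus on the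
   spectral decomposition A = P^-1 diag(d) P (P unitary) of the normal matrix A;
   the eigenvalues d_i are positive reals and are mapped to d_i^t. *)
Definition mxpow n (A : 'M[C]_n) (t : R) : 'M[C]_n :=
  invmx (spectralmx A)
  *m diag_mx (map_mx (fun z : C => ((powR (complex.Re z) t)%:C)%C) (spectral_diag A))
  *m spectralmx A.

(* geometric mean  A # B = A^{1/2} (A^{-1/2} B A^{-1/2})^{1/2} A^{1/2} *)
Definition gmean n (A B : 'M[C]_n) : 'M[C]_n :=
  mxpow A (1/2) *m mxpow (mxpow A (-(1/2)) *m B *m mxpow A (-(1/2))) (1/2)
  *m mxpow A (1/2).

(* A \widehat{sp}_t B = (A^{-1} # B)^t A (A^{-1} # B)^t *)
Definition spt n (A B : 'M[C]_n) (t : R) : 'M[C]_n :=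
  mxpow (gmean (invmx A) B) t *m A *m mxpow (gmean (invmx A) B) t.

(* eigenvalues (with algebraic multiplicity) = roots of the characteristic
   polynomial; for positive semidefinite matrices they are real, and we list
   their real parts in non-increasing order lambda_1 >= ... >= lambda_n. *)
Definition eigs n (X : 'M[C]_n) : seq R :=
  sort (fun x y : R => y <= x)
       [seq complex.Re z | z <- sval (closed_field_poly_normal (char_poly X))].

(* log-majorization X <_log Y *)
Definition logmaj n (X Y : 'M[C]_n) : Prop :=
  (forall k : nat, (1 <= k <= n - 1)%N ->
     \prod_(j < k) (eigs X)`_j <= \prod_(j < k) (eigs Y)`_j)
  /\ \det X = \det Y.

End Defs.

(* Main.v *)
(* Write [s = - t], [q = 1 / (2 s)] in [[1/2, 1]], [G = A^-1 # B] and [H = G^-1]; then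
   [G A G = B], so [H A^-1 H = B^-1].  Let [N] be the logarithm of the product of the [k]
   largest singular values.  Writing [G^t A G^t] and [A^{1-t} B^{2t} A^{1-t}] as Gram
   matrices, the claim for [k] is [N (A^{1/2} G^t) <= N (A^{1+s} B^{-s}) / 2], and

     N (A^{1/2} G^t) = N (A^{1/2} H^s)
                    <= s N (A^q H)
                    <= s N (A^{q+1/2} H A^{-1/2}) = s N (A^{q+1/2} B^{-1/2})
                    <= s q N (A^{1+s} B^{-s}).

   All three inequalities are instances of one fact: [x |-> N (X^x S Y^x)] is convex.
   With [S = 1] this gives the Cordes-type first and last ones; with [Y = X^-1] and [S]
   Hermitian the function is moreover even, hence nondecreasing on [x >= 0], which is the
   middle one.  Midpoint convexity combines Weyl's inequality (the logarithm of the product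
   of the [k] largest eigenvalues is at most [N]) with the subadditivity of [N]; both come
   from maximising [det (V P V^* )] over [k]-frames [V], without exterior powers. *)
Require Import Defs.
From HB Require Import structures.
From mathcomp Require Import all_boot all_order all_algebra all_fingroup.
From mathcomp Require Import sesquilinear spectral complex.
From mathcomp Require Import classical_sets reals sequences exp.
From mathcomp Require Import ring lra.
Import Order.TTheory GRing.Theory Num.Theory.
Set Implicit Arguments.
Unset Strict Implicit.
Unset Printing Implicit Defensive.
Local Open Scope ring_scope.
Local Open Scope sesquilinear_scope.

Section CauchyBinet.
Variables (K : comNzRingType) (k n : nat).
Implicit Types (A : 'M[K]_(k, n)) (B : 'M[K]_(n, k)) (f : {ffun 'I_k -> 'I_n}).

Lemma det_mulmx_sum_rowsub A B :
  \det (A *m B) = \sum_(f : {ffun 'I_k -> 'I_n}) (\prod_i A i (f i)) * \det (rowsub f B).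
Proof.
pose AB (s : 'S_k) i j := A i j * B j (s i).
transitivity (\sum_(f : {ffun 'I_k -> 'I_n})
    \sum_(s : 'S_k) (-1) ^+ s * \prod_i AB s i (f i)).
  rewrite exchange_big; apply: eq_bigr => /= s _; rewrite -big_distrr /=.
  congr (_ * _); rewrite -(bigA_distr_bigA (AB s)) /=.
  by apply: eq_bigr => i _; rewrite mxE.
apply: eq_bigr => f _; rewrite mulr_sumr; apply: eq_bigr => s _.
rewrite mulrCA -big_split /=; congr (_ * _).
by apply: eq_bigr => i _; rewrite mxE.
Qed.

Lemma det_mulmx_sum_perm A B (s : 'S_k) :
  \det (A *m B) =
  \sum_(f : {ffun 'I_k -> 'I_n})
    (-1) ^+ s * (\prod_i (colsub f A) i (s i)) * \det (rowsub f B).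
Proof.
pose reindex_by f : {ffun 'I_k -> 'I_n} := [ffun i => f (s i)].
have reindex_by_inj : injective reindex_by.
  move=> f g /ffunP fg; apply/ffunP => i.
  by have := fg (s^-1 i)%g; rewrite !ffunE permKV.
rewrite det_mulmx_sum_rowsub (reindex_inj reindex_by_inj) /=.
apply: eq_bigr => f _.
have -> : rowsub (reindex_by f) B = row_perm s (rowsub f B).
  by apply/matrixP => i j; rewrite !mxE ffunE.
rewrite row_permE det_mulmx det_perm mulrA [_ * (-1) ^+ s]mulrC.
by do 2!congr (_ * _); apply: eq_bigr => i _; rewrite ffunE mxE.
Qed.

(* Summing over all index maps rather than over subsets counts every minor [k`!] times. *)
Lemma Cauchy_Binet A B :
  \det (A *m B) *+ k`! =
  \sum_(f : {ffun 'I_k -> 'I_n}) \det (colsub f A) * \det (rowsub f B).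
Proof.
have {1}-> : k`! = #|{perm 'I_k}| by rewrite -(card_Sn k); apply: eq_card.
rewrite -sumr_const (eq_bigr _ (fun s _ => det_mulmx_sum_perm A B s)).
by rewrite exchange_big /=; apply: eq_bigr => f _; rewrite -mulr_suml.
Qed.

Lemma det_colsub_mul_diag A (d : 'rV[K]_n) f :
  \det (colsub f (A *m diag_mx d)) = \det (colsub f A) * \prod_i d 0 (f i).
Proof.
have -> : colsub f (A *m diag_mx d) = colsub f A *m diag_mx (\row_i d 0 (f i)).
  by apply/matrixP => i j; rewrite !mul_mx_diag !mxE.
by rewrite det_mulmx det_diag; congr (_ * _); apply: eq_bigr => i _; rewrite mxE.
Qed.

Lemma det_colsub_eq0 A f : ~~ injectiveb f -> \det (colsub f A) = 0.
Proof.
case/injectivePn => i [j ij fij].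
by rewrite -det_tr (determinant_alternate ij) // => l; rewrite !mxE fij.
Qed.

End CauchyBinet.

Lemma ler_prod_inj_antitone (K : realDomainType) k (d : nat -> K) (f : 'I_k -> nat) :
    (forall i, 0 <= d i) -> {homo d : i j / (i <= j)%N >-> j <= i} ->
    injective f ->
  \prod_i d (f i) <= \prod_(j < k) d j.
Proof.
move=> d_ge0 d_anti; elim: k f => [|k IHk] f f_inj; first by rewrite !big_ord0.
have [i0 fi0] : exists i0, (k <= f i0)%N.
  apply/existsP; rewrite -[[exists _, _]]negbK negb_exists; apply/negP => /forallP fk.
  have fk' i : (f i < k)%N by rewrite ltnNge fk.
  have : injective (fun i => Ordinal (fk' i)) by move=> i j [] /f_inj.
  by move/leq_card; rewrite !card_ord ltnn.
rewrite (bigD1_ord i0) //= big_ord_recr /= mulrC.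
apply: ler_pM; rewrite ?prodr_ge0 //; last exact: d_anti.
by apply: (IHk (fun i => f (lift i0 i))) => i j /f_inj /lift_inj.
Qed.

Lemma ln_prod (R : realType) (I : finType) (F : I -> R) : (forall i, 0 < F i) ->
  ln (\prod_i F i) = \sum_i ln (F i).
Proof.
move=> F_gt0; suff [] : ln (\prod_i F i) = \sum_i ln (F i) /\ 0 < \prod_i F i by [].
elim/big_ind2: _ => [|x1 x2 y1 y2 [<- x1_gt0] [<- y1_gt0]|i _] //; first by rewrite ln1.
by rewrite lnM // mulr_gt0.
Qed.

Section MidpointConvex.
Variable R : realType.

Definition midpoint_convex (a b : R) (g : R -> R) : Prop :=
  forall x y, a <= x <= b -> a <= y <= b -> g ((x + y) / 2) <= (g x + g y) / 2.

(* Every point of [[0, 1]] is the midpoint of an endpoint and another point, so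
   [h <= sup h / 2], hence [sup h <= 0]. *)
Lemma midpoint_convex_le0 (h : R -> R) (K : R) : midpoint_convex 0 1 h ->
    (forall x, 0 <= x <= 1 -> h x <= K) -> h 0 <= 0 -> h 1 <= 0 ->
  forall x, 0 <= x <= 1 -> h x <= 0.
Proof.
move=> h_mid h_bounded h0 h1.
pose E := [set h x | x in [set x | 0 <= x <= 1]]%classic.
have zeroI : 0 <= (0 : R) <= 1 by lra.
have oneI : 0 <= (1 : R) <= 1 by lra.
have E_neq0 : (E !=set0)%classic by exists (h 0), 0.
have le_sup x : 0 <= x <= 1 -> h x <= sup E.
  move=> xI; apply: sup_upper_bound; last by exists x.
  by split=> //; exists K => _ [y yI <-]; apply: h_bounded.
suff supE_le : sup E <= sup E / 2 by move=> x /le_sup; lra.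
apply: ge_sup => // _ [x /= xI <-].
have [x_le|x_ge] := lerP x (1/2).
  have yI : 0 <= 2 * x <= 1 by lra.
  have := h_mid _ _ zeroI yI; rewrite (_ : (0 + 2 * x) / 2 = x); last by field.
  by have := le_sup _ yI; lra.
have yI : 0 <= 2 * x - 1 <= 1 by lra.
have := h_mid _ _ oneI yI; rewrite (_ : (1 + (2 * x - 1)) / 2 = x); last by field.
by have := le_sup _ yI; lra.
Qed.

Lemma midpoint_convex_le_chord (g : R -> R) (a b K : R) : a <= b ->
    midpoint_convex a b g -> (forall x, a <= x <= b -> g x <= K) ->
  forall x, 0 <= x <= 1 -> g ((1 - x) * a + x * b) <= (1 - x) * g a + x * g b.
Proof.
move=> ab g_mid g_bounded x xI; rewrite -subr_le0.
have seg y : 0 <= y <= 1 -> a <= (1 - y) * a + y * b <= b.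
  by move=> /andP[y_ge0 y_le1]; apply/andP; split; nra.
pose h y := g ((1 - y) * a + y * b) - ((1 - y) * g a + y * g b).
pose m := Num.min (g a) (g b).
apply: (@midpoint_convex_le0 h (K - m)) => //; rewrite /h.
- move=> y z /seg yI /seg zI; have := g_mid _ _ yI zI.
  have -> : ((1 - y) * a + y * b + ((1 - z) * a + z * b)) / 2 =
      (1 - (y + z) / 2) * a + (y + z) / 2 * b by field.
  by lra.
- move=> y yI; apply: lerB; first exact: g_bounded (seg _ yI).
  have ma : m <= g a by rewrite ge_min lexx.
  have mb : m <= g b by rewrite ge_min lexx orbT.
  by case/andP: yI => y_ge0 y_le1; nra.
- by rewrite subr0 !mul1r !mul0r !addr0 subrr.
- by rewrite subrr !mul0r !mul1r !add0r subrr.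
Qed.

End MidpointConvex.

Section ConjTranspose.
Variable C : numClosedFieldType.

Lemma trmxC_mul m n p (A : 'M[C]_(m, n)) (B : 'M[C]_(n, p)) :
  (A *m B) ^t* = B ^t* *m A ^t*.
Proof. by rewrite trmx_mul map_mxM. Qed.

Lemma trmxC_unit n (A : 'M[C]_n) : (A ^t* \in unitmx) = (A \in unitmx).
Proof. by rewrite map_unitmx unitmx_tr. Qed.

Lemma det_trmxC n (A : 'M[C]_n) : \det (A ^t*) = (\det A)^*.
Proof. by rewrite det_map_mx det_tr. Qed.

Lemma hermsymmxP n (A : 'M[C]_n) : reflect (A ^t* = A) (A \is hermsymmx).
Proof.
by apply: (iffP (is_hermitianmxP _ _ _)); rewrite expr0 scale1r => /esym.
Qed.

Lemma unitary_row_free m n (V : 'M[C]_(m, n)) : V \is unitarymx -> row_free V.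
Proof. by move=> /mxrank_unitary rV; rewrite /row_free rV. Qed.

Lemma rowsub_unitary m n p (f : 'I_m -> 'I_n) (U : 'M[C]_(n, p)) :
  injective f -> U \is unitarymx -> rowsub f U \is unitarymx.
Proof.
move=> f_inj /unitarymxP U_unitary; apply/unitarymxP/matrixP => i j.
have /matrixP/(_ (f i) (f j)) := U_unitary; rewrite !mxE (inj_eq f_inj) => <-.
by apply: eq_bigr => l _; rewrite !mxE.
Qed.

Lemma det_compress_diag_le k n (W : 'M[C]_(k, n)) (d : 'rV[C]_n) (c : C) :
    (forall f : 'I_k -> 'I_n, injective f -> \prod_i d 0 (f i) <= c) ->
  \det (W *m diag_mx d *m W ^t*) <= c * \det (W *m W ^t*).
Proof.
move=> d_le; rewrite -(ler_pMn2r (fact_gt0 k)) -mulrnAr !Cauchy_Binet mulr_sumr.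
apply: ler_sum => f _; rewrite det_colsub_mul_diag.
have -> : rowsub f (W ^t*) = (colsub f W) ^t* by apply/matrixP => i j; rewrite !mxE.
rewrite det_trmxC mulrAC [leLHS]mulrC.
have [/injectiveP f_inj|/det_colsub_eq0->] := boolP (injectiveb f); last first.
  by rewrite mul0r !mulr0.
by apply: ler_wpM2r; [exact: mul_conjC_ge0 | exact: d_le].
Qed.

End ConjTranspose.

Lemma invmx_mulmx (K : comUnitRingType) n (X Y : 'M[K]_n) :
  X \in unitmx -> Y \in unitmx -> invmx (X *m Y) = invmx Y *m invmx X.
Proof.
move=> X_unit Y_unit; have XY_unit : X *m Y \in unitmx by rewrite unitmx_mul X_unit.
by apply: (can_inj (mulKmx XY_unit)); rewrite mulmxV // mulmxA mulmxK // mulmxV.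
Qed.

Lemma char_poly_similar (K : comUnitRingType) n (Z X : 'M[K]_n) : Z \in unitmx ->
  char_poly (Z *m X *m invmx Z) = char_poly X.
Proof.
move=> Z_unit; have ZpK : map_mx polyC Z *m map_mx polyC (invmx Z) = 1%:M.
  by rewrite -map_mxM mulmxV // map_mx1.
rewrite /char_poly.
have -> : char_poly_mx (Z *m X *m invmx Z) =
    map_mx polyC Z *m char_poly_mx X *m map_mx polyC (invmx Z).
  rewrite /char_poly_mx mulmxBr mulmxBl !map_mxM; congr (_ - _).
  by rewrite mul_mx_scalar -scalemxAl ZpK scalemx1.
by rewrite !det_mulmx mulrAC -det_mulmx ZpK det1 mul1r.
Qed.

(* [D W = W E] entrywise says that [W i j != 0] forces equal eigenvalues, so the same
   intertwining relation holds after applying a function to both diagonals. *)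
Lemma diag_mx_intertwine_map (K : idomainType) (f : K -> K) m n (D : 'rV[K]_m)
    (E : 'rV[K]_n) (W : 'M[K]_(m, n)) :
  diag_mx D *m W = W *m diag_mx E ->
  diag_mx (map_mx f D) *m W = W *m diag_mx (map_mx f E).
Proof.
move=> /matrixP DW; apply/matrixP => i j; have := DW i j.
rewrite !mul_diag_mx !mul_mx_diag !mxE.
have [->|Wij] := eqVneq (W i j) 0; first by rewrite !mulr0 !mul0r.
by rewrite [W i j * _]mulrC => /(mulIf Wij) ->; rewrite mulrC.
Qed.

Lemma eq_diagonalization_map (K : fieldType) (f : K -> K) n (P Q : 'M[K]_n)
    (D E : 'rV[K]_n) : P \in unitmx -> Q \in unitmx ->
  invmx P *m diag_mx D *m P = invmx Q *m diag_mx E *m Q ->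
  invmx P *m diag_mx (map_mx f D) *m P = invmx Q *m diag_mx (map_mx f E) *m Q.
Proof.
move=> P_unit Q_unit eqDE; set W := P *m invmx Q.
have DW : diag_mx D *m W = W *m diag_mx E.
  have := congr1 (fun X => P *m X *m invmx Q) eqDE.
  by rewrite /= !mulmxA mulmxK // mulmxV // mul1mx => ->.
have PE : P = W *m Q by rewrite mulmxKV.
rewrite {2}PE mulmxA -[_ *m _ *m W]mulmxA (diag_mx_intertwine_map f DW).
by rewrite /W !mulmxA mulVmx // mul1mx.
Qed.

Lemma conj_diag_mx_perm (K : comUnitRingType) n (p : 'S_n) (D : 'rV[K]_n) (U : 'M[K]_n) :
    U \in unitmx ->
  invmx (row_perm p U) *m diag_mx (col_perm p D) *m row_perm p U =
  invmx U *m diag_mx D *m U.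
Proof.
move=> U_unit; rewrite row_permE.
have pU_unit : perm_mx p *m U \in unitmx by rewrite unitmx_mul unitmx_perm.
apply: (can_inj (mulKmx pU_unit)); rewrite !mulmxA mulmxV // mul1mx mulmxK //.
congr (_ *m _); rewrite mul_diag_mx mul_mx_diag; apply/matrixP => i j; rewrite !mxE.
by have [<-|_] := eqVneq (p i) j; rewrite ?mulr0 ?mul0r // mulrC.
Qed.

Section RealDiagonal.
Variables (R : realType) (n : nat).
Implicit Types d e : 'I_n -> R.

Definition rdiag_mx d : 'M[R[i]]_n := diag_mx (\row_i (d i)%:C%C).

Lemma eq_rdiag_mx d e : d =1 e -> rdiag_mx d = rdiag_mx e.
Proof. by move=> de; congr diag_mx; apply/rowP => i; rewrite !mxE de. Qed.

Lemma rdiag_mx_Re (D : 'rV[R[i]]_n) : (forall i, D 0 i \is Num.real) ->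
  rdiag_mx (fun i => complex.Re (D 0 i)) = diag_mx D.
Proof. by move=> D_real; congr diag_mx; apply/rowP => i; rewrite mxE RRe_real. Qed.

Lemma rdiag_mx1 : rdiag_mx (fun=> 1) = 1%:M.
Proof. by rewrite -diag_const_mx; congr diag_mx; apply/rowP => i; rewrite !mxE. Qed.

Lemma mul_rdiag_mx d e : rdiag_mx d *m rdiag_mx e = rdiag_mx (fun i => d i * e i).
Proof.
by rewrite /rdiag_mx mulmx_diag; congr diag_mx; apply/rowP => i; rewrite !mxE rmorphM.
Qed.

Lemma det_rdiag_mx d : \det (rdiag_mx d) = (\prod_i d i)%:C%C.
Proof. by rewrite det_diag rmorph_prod; apply: eq_bigr => i _; rewrite mxE. Qed.

Lemma trmxC_rdiag_mx d : (rdiag_mx d) ^t* = rdiag_mx d.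
Proof.
rewrite /rdiag_mx tr_diag_mx map_diag_mx; congr diag_mx; apply/rowP => i.
by rewrite !mxE; apply/CrealP/complex_realP; exists (d i).
Qed.

Lemma posdef_rdiag_mx d : (forall i, 0 < d i) -> posdef (rdiag_mx d).
Proof.
move=> d_gt0; split; first by apply/hermsymmxP; rewrite trmxC_rdiag_mx.
move=> x /rV0Pn[i xi0].
have -> : (x *m rdiag_mx d *m x ^t*) 0 0 = \sum_j (d j)%:C%C * (x 0 j * (x 0 j)^*).
  rewrite mul_mx_diag mxE; apply: eq_bigr => j _.
  by rewrite !mxE mulrA [x 0 j * _]mulrC.
have ge0 j : 0 <= (d j)%:C%C * (x 0 j * (x 0 j)^*).
  by rewrite mulr_ge0 ?mul_conjC_ge0 // ler0c ltW.
rewrite (bigD1 i) //= ltr_wpDr ?sumr_ge0 //.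
by rewrite mulr_gt0 ?mul_conjC_gt0 // ltcR.
Qed.

End RealDiagonal.

Section Spectral.
Variables (R : realType) (n : nat).
Implicit Types (d e : 'I_n -> R) (A P U X Y : 'M[R[i]]_n).

Lemma posdef_trmxC A : posdef A -> A ^t* = A.
Proof. by case=> /hermsymmxP. Qed.

Lemma posdef_congr m (X : 'M[R[i]]_(m, n)) P :
  posdef P -> row_free X -> posdef (X *m P *m X ^t*).
Proof.
move=> [/hermsymmxP P_herm P_gt0] X_free; split.
  by apply/hermsymmxP; rewrite !trmxC_mul trmxCK P_herm mulmxA.
move=> x x0; have := P_gt0 (x *m X); rewrite trmxC_mul !mulmxA; apply.
by rewrite mulmx_free_eq0.
Qed.

Lemma posdef1 : posdef (1%:M : 'M[R[i]]_n).
Proof. by rewrite -rdiag_mx1; apply: posdef_rdiag_mx. Qed.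

Lemma posdef_gram m (X : 'M[R[i]]_(m, n)) : row_free X -> posdef (X *m X ^t*).
Proof.
by move=> X_free; rewrite -[X in X *m _]mulmx1; apply: posdef_congr posdef1 X_free.
Qed.

Lemma posdef_gram_unit X : X \in unitmx -> posdef (X *m X ^t*).
Proof. by rewrite -row_free_unit => /posdef_gram. Qed.

Lemma posdef_diag_gt0 P i : posdef P -> 0 < P i i.
Proof.
have delta_neq0 : delta_mx 0 i != 0 :> 'rV[R[i]]_n.
  by apply/rV0Pn; exists i; rewrite mxE !eqxx oner_neq0.
move=> [_ /(_ _ delta_neq0)]; rewrite trmx_delta map_delta_mx -rowE -colE.
by rewrite !mxE.
Qed.

Definition conj_rdiag_mx U d : 'M[R[i]]_n := invmx U *m rdiag_mx d *m U.

Lemma eq_conj_rdiag_mx U d e : d =1 e -> conj_rdiag_mx U d = conj_rdiag_mx U e.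
Proof. by rewrite /conj_rdiag_mx => /eq_rdiag_mx ->. Qed.

Lemma mul_conj_rdiag_mx U d e : U \in unitmx ->
  conj_rdiag_mx U d *m conj_rdiag_mx U e = conj_rdiag_mx U (fun i => d i * e i).
Proof. by move=> U_unit; rewrite /conj_rdiag_mx -mul_rdiag_mx !mulmxA mulmxK. Qed.

Lemma conj_rdiag_mx1 U : U \in unitmx -> conj_rdiag_mx U (fun=> 1) = 1%:M.
Proof. by move=> U_unit; rewrite /conj_rdiag_mx rdiag_mx1 mulmx1 mulVmx. Qed.

Lemma det_conj_rdiag_mx U d : U \in unitmx ->
  \det (conj_rdiag_mx U d) = (\prod_i d i)%:C%C.
Proof.
move=> U_unit; rewrite /conj_rdiag_mx !det_mulmx det_rdiag_mx mulrAC -det_mulmx.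
by rewrite mulVmx // det1 mul1r.
Qed.

Lemma conj_rdiag_mx_perm (p : 'S_n) U d : U \in unitmx ->
  conj_rdiag_mx (row_perm p U) (fun i => d (p i)) = conj_rdiag_mx U d.
Proof.
move=> U_unit; rewrite /conj_rdiag_mx -(conj_diag_mx_perm p _ U_unit).
suff -> : col_perm p (\row_i (d i)%:C%C) = \row_i (d (p i))%:C%C :> 'rV[R[i]]_n by [].
by apply/rowP => i; rewrite !mxE.
Qed.

Lemma posdef_conj_rdiag_mx U d :
  U \is unitarymx -> (forall i, 0 < d i) -> posdef (conj_rdiag_mx U d).
Proof.
move=> U_unitary d_gt0; rewrite /conj_rdiag_mx invmx_unitary // -{2}[U]trmxCK.
apply: posdef_congr; first exact: posdef_rdiag_mx.
by rewrite row_free_unit trmxC_unit unitarymx_unit.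
Qed.

Lemma posdef_spectral A : posdef A ->
  exists U d, [/\ U \is unitarymx, forall i, 0 < d i & A = conj_rdiag_mx U d].
Proof.
move=> A_pos; have [/hermitian_normalmx/orthomx_spectralP] := A_pos.
move: (spectral_unitarymx A); move: (spectralmx A) (spectral_diag A) => U D.
move=> U_unitary AE _.
have D_gt0 i : 0 < D 0 i.
  have := posdef_diag_gt0 i (posdef_congr A_pos (unitary_row_free U_unitary)).
  rewrite AE -invmx_unitary // !mulmxA mulmxV ?mul1mx ?mulmxK ?unitarymx_unit //.
  by rewrite mxE eqxx.
exists U, (fun i => complex.Re (D 0 i)); split; [exact: U_unitary | move=> i |].
  by have := D_gt0 i; rewrite ltcE => /andP[].
by rewrite /conj_rdiag_mx rdiag_mx_Re // => i; rewrite gtr0_real.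
Qed.

Lemma posdef_unit A : posdef A -> A \in unitmx.
Proof.
move=> /posdef_spectral[U [d [/unitarymx_unit U_unit d_gt0 ->]]].
rewrite unitmxE unitfE det_conj_rdiag_mx //.
by rewrite gt_eqF // ltcR prodr_gt0.
Qed.

Lemma posdef_sandwich A X : posdef A -> posdef X -> posdef (A *m X *m A).
Proof.
move=> A_pos X_pos; rewrite -{2}(posdef_trmxC A_pos).
by apply: posdef_congr => //; rewrite row_free_unit posdef_unit.
Qed.

Definition logdet X : R := ln (complex.Re `|\det X|).

Lemma logdetM X Y : X \in unitmx -> Y \in unitmx ->
  logdet (X *m Y) = logdet X + logdet Y.
Proof.
have normdetE (Z : 'M[R[i]]_n) : Z \in unitmx ->
    exists2 z : R, 0 < z & `|\det Z| = z%:C%C.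
  rewrite unitmxE unitfE -normr_gt0 => detZ_gt0; exists (complex.Re `|\det Z|).
    by move: detZ_gt0; rewrite ltcE => /andP[].
  by rewrite RRe_real // gtr0_real.
move=> /normdetE[x x_gt0 xE] /normdetE[y y_gt0 yE].
by rewrite /logdet det_mulmx normrM xE yE -rmorphM lnM.
Qed.

Lemma logdet_conj_rdiag_mx U d : U \in unitmx -> (forall i, 0 < d i) ->
  logdet (conj_rdiag_mx U d) = ln (\prod_i d i).
Proof.
move=> U_unit d_gt0; rewrite /logdet (det_conj_rdiag_mx _ U_unit) ger0_norm //.
by rewrite ler0c ltW // prodr_gt0.
Qed.

Lemma det_posdef A : posdef A -> \det A = (expR (logdet A))%:C%C.
Proof.
move=> /posdef_spectral[U [d [/unitarymx_unit U_unit d_gt0 ->]]].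
rewrite (logdet_conj_rdiag_mx U_unit d_gt0) (det_conj_rdiag_mx _ U_unit).
by rewrite lnK // posrE prodr_gt0.
Qed.

End Spectral.

(* A sealed copy of [mxpow], which unification would otherwise unfold to a product. *)
HB.lock Definition hpow (R : realType) n (A : 'M[R[i]]_n) (t : R) : 'M[R[i]]_n :=
  mxpow A t.

Section HermitianPower.
Variables (R : realType) (n : nat).
Implicit Types (d : 'I_n -> R) (A U X : 'M[R[i]]_n) (s t : R).

Lemma hpowE A t : hpow A t = mxpow A t.
Proof. by rewrite hpow.unlock. Qed.

Lemma hpow_conj_rdiag_mx U d t : U \is unitarymx -> (forall i, 0 < d i) ->
  hpow (conj_rdiag_mx U d) t = conj_rdiag_mx U (fun i => d i `^ t).
Proof.
move=> U_unitary d_gt0.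
have [/hermitian_normalmx/orthomx_spectralP AE _] := posdef_conj_rdiag_mx U_unitary d_gt0.
move: AE (spectral_unit (conj_rdiag_mx U d)); rewrite hpowE /mxpow.
move: (spectralmx _) (spectral_diag _) => Q D AE Q_unit.
apply: etrans (eq_diagonalization_map _ Q_unit (unitarymx_unit U_unitary) (esym AE)) _.
rewrite /conj_rdiag_mx.
suff -> : map_mx (fun z : R[i] => (powR (complex.Re z) t)%:C%C) (\row_i (d i)%:C%C) =
    \row_i (d i `^ t)%:C%C by [].
by apply/rowP => i; rewrite !mxE.
Qed.

Lemma posdef_hpow A t : posdef A -> posdef (hpow A t).
Proof.
move=> /posdef_spectral[U [d [U_unitary d_gt0 ->]]].
rewrite (hpow_conj_rdiag_mx _ U_unitary d_gt0).
by apply: posdef_conj_rdiag_mx => // i; rewrite powR_gt0.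
Qed.

Lemma unitmx_hpow A t : posdef A -> hpow A t \in unitmx.
Proof. by move=> /posdef_hpow-/(_ t)/posdef_unit. Qed.

Lemma trmxC_hpow A t : posdef A -> (hpow A t) ^t* = hpow A t.
Proof. by move=> /posdef_hpow-/(_ t)/posdef_trmxC. Qed.

Lemma hpowD A s t : posdef A -> hpow A (s + t) = hpow A s *m hpow A t.
Proof.
move=> /posdef_spectral[U [d [U_unitary d_gt0 ->]]].
rewrite !(hpow_conj_rdiag_mx _ U_unitary d_gt0).
rewrite (mul_conj_rdiag_mx _ _ (unitarymx_unit U_unitary)); apply: eq_conj_rdiag_mx => i.
by rewrite powRD // (gt_eqF (d_gt0 i)) implybT.
Qed.

Lemma hpow0 A : posdef A -> hpow A 0 = 1%:M.
Proof.
move=> /posdef_spectral[U [d [U_unitary d_gt0 ->]]].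
rewrite (hpow_conj_rdiag_mx _ U_unitary d_gt0).
rewrite -(conj_rdiag_mx1 (unitarymx_unit U_unitary)).
by apply: eq_conj_rdiag_mx => i; rewrite powRr0.
Qed.

Lemma hpow1 A : posdef A -> hpow A 1 = A.
Proof.
move=> /posdef_spectral[U [d [U_unitary d_gt0 ->]]].
rewrite (hpow_conj_rdiag_mx _ U_unitary d_gt0).
by apply: eq_conj_rdiag_mx => i; rewrite powRr1 // ltW.
Qed.

Lemma hpowM A s t : posdef A -> hpow A (s * t) = hpow (hpow A s) t.
Proof.
move=> /posdef_spectral[U [d [U_unitary d_gt0 ->]]].
have ds_gt0 i : 0 < d i `^ s by rewrite powR_gt0.
rewrite !(hpow_conj_rdiag_mx _ U_unitary d_gt0, hpow_conj_rdiag_mx _ U_unitary ds_gt0).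
by apply: eq_conj_rdiag_mx => i; rewrite powRrM.
Qed.

Lemma hpowN A t : posdef A -> hpow A (- t) = invmx (hpow A t).
Proof.
move=> A_pos; apply: (can_inj (mulKmx (unitmx_hpow t A_pos))).
by rewrite mulmxV ?unitmx_hpow // -hpowD // subrr hpow0.
Qed.

Lemma hpowN1 A : posdef A -> hpow A (- 1) = invmx A.
Proof. by move=> A_pos; rewrite hpowN // hpow1. Qed.

Lemma posdef_invmx A : posdef A -> posdef (invmx A).
Proof. by move=> A_pos; rewrite -(hpowN1 A_pos); apply: posdef_hpow. Qed.

Lemma hpow_half_sqr A : posdef A -> hpow A (1/2) *m hpow A (1/2) = A.
Proof.
move=> A_pos; rewrite -hpowD //.
by rewrite (_ : 1/2 + 1/2 = 1) ?hpow1 //; field.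
Qed.

Lemma mul_hpow_sandwich A X (a b c d : R) : posdef A ->
  hpow A a *m (hpow A b *m X *m hpow A c) *m hpow A d =
  hpow A (a + b) *m X *m hpow A (c + d).
Proof. by move=> A_pos; rewrite !hpowD // !mulmxA. Qed.

Lemma logdet_hpow A t : posdef A -> logdet (hpow A t) = t * logdet A.
Proof.
move=> /posdef_spectral[U [d [U_unitary d_gt0 ->]]].
have U_unit := unitarymx_unit U_unitary.
have dt_gt0 i : 0 < d i `^ t by rewrite powR_gt0.
rewrite (hpow_conj_rdiag_mx _ U_unitary d_gt0).
rewrite [LHS](logdet_conj_rdiag_mx U_unit dt_gt0) (logdet_conj_rdiag_mx U_unit d_gt0).
by rewrite !ln_prod // mulr_sumr; apply: eq_bigr => i _; rewrite ln_powR.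
Qed.

End HermitianPower.

Section Eigenvalues.
Variables (R : realType) (n : nat).
Implicit Types (d : 'I_n -> R) (P U X Y Z : 'M[R[i]]_n) (t : R).

Lemma eigs_similar Z X : Z \in unitmx -> eigs (Z *m X *m invmx Z) = eigs X.
Proof. by move=> Z_unit; rewrite /eigs char_poly_similar. Qed.

Lemma eigs_mulC X Y : X \in unitmx -> eigs (X *m Y) = eigs (Y *m X).
Proof.
move=> X_unit; rewrite -[in RHS](eigs_similar _ X_unit); congr eigs.
by rewrite !mulmxA mulmxK.
Qed.

Lemma eigs_sorted X : sorted >=%R (eigs X).
Proof. by apply: sort_sorted => x y; apply: le_total. Qed.

Lemma eigs_rdiag_mx d : perm_eq (eigs (rdiag_mx d)) [tuple d i | i < n].
Proof.
rewrite /eigs; case: closed_field_poly_normal => r /= rE; rewrite perm_sort.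
have r_perm : perm_eq r [seq (d i)%:C%C | i <- enum 'I_n].
  apply: prod_XsubC_eq; move: rE.
  rewrite (monicP (char_poly_monic _)) scale1r => <-.
  rewrite char_poly_trig ?diag_mx_is_trig // big_map big_enum.
  by apply: eq_bigr => i _; rewrite !mxE eqxx mulr1n.
by have := perm_map (@complex.Re R) r_perm; rewrite -map_comp.
Qed.

Lemma eigs_conj_rdiag_mx U d : U \in unitmx ->
  perm_eq (eigs (conj_rdiag_mx U d)) [tuple d i | i < n].
Proof.
move=> U_unit; rewrite -[conj_rdiag_mx U d](mulKmx U_unit) eigs_mulC ?unitmx_inv //.
by rewrite /conj_rdiag_mx !mulmxA mulmxV // mul1mx mulmxK // eigs_rdiag_mx.
Qed.

Lemma eigs_conj_rdiag_mx_sorted U d : U \in unitmx ->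
  {homo d : i j / (i <= j)%N >-> j <= i} ->
  eigs (conj_rdiag_mx U d) = [tuple d i | i < n].
Proof.
move=> U_unit d_anti; have := eigs_conj_rdiag_mx d U_unit.
apply: (sorted_eq ge_trans ge_anti (eigs_sorted _)).
apply/(sortedP 0) => j; rewrite size_tuple => jn.
rewrite (nth_mktuple d 0 (Ordinal jn)) (nth_mktuple d 0 (Ordinal (ltnW jn))).
exact: d_anti.
Qed.

Lemma size_eigs P : posdef P -> size (eigs P) = n.
Proof.
move=> /posdef_spectral[U [d [/unitarymx_unit U_unit d_gt0 ->]]].
by rewrite (perm_size (eigs_conj_rdiag_mx d U_unit)) size_tuple.
Qed.

Lemma nth_eigs_gt0 P i : posdef P -> (i < n)%N -> 0 < (eigs P)`_i.
Proof.
move=> P_pos i_lt_n; have : (eigs P)`_i \in eigs P by rewrite mem_nth // size_eigs.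
have [U [d [/unitarymx_unit U_unit d_gt0 {2}->]]] := posdef_spectral P_pos.
by rewrite (perm_mem (eigs_conj_rdiag_mx d U_unit)) => /mapP[j _ ->].
Qed.

Lemma nth_eigs_ge0 P i : posdef P -> 0 <= (eigs P)`_i.
Proof.
move=> P_pos; have [i_n|n_i] := ltnP i n; first exact/ltW/nth_eigs_gt0.
by rewrite nth_default // size_eigs.
Qed.

Lemma nth_eigs_antitone P : posdef P ->
  {homo nth 0 (eigs P) : i j / (i <= j)%N >-> j <= i}.
Proof.
move=> P_pos i j ij; have [j_n|n_j] := ltnP j n; last first.
  by rewrite [leLHS]nth_default ?size_eigs // nth_eigs_ge0.
apply: (sorted_leq_nth ge_trans lexx 0 (eigs_sorted P)) => //.
- by rewrite inE size_eigs // (leq_ltn_trans ij).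
- by rewrite inE size_eigs.
Qed.

Lemma posdef_spectral_eigs P : posdef P ->
  exists2 U : 'M[R[i]]_n, U \is unitarymx &
    P = conj_rdiag_mx U (fun i : 'I_n => (eigs P)`_i).
Proof.
move=> P_pos; have [U [d [U_unitary _ PE]]] := posdef_spectral P_pos.
have U_unit := unitarymx_unit U_unitary.
have /tuple_permP[p eigsE] := eigs_conj_rdiag_mx d U_unit; rewrite -PE in eigsE.
exists (row_perm p U); first by rewrite row_permEsub; exact: rowsub_unitary perm_inj _.
rewrite {1}PE -(conj_rdiag_mx_perm p d U_unit).
by apply: eq_conj_rdiag_mx => i; rewrite eigsE nth_mktuple tnth_mktuple.
Qed.

Lemma nth_eigs_hpow P t i : posdef P -> 0 <= t -> (i < n)%N ->
  (eigs (hpow P t))`_i = (eigs P)`_i `^ t.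
Proof.
move=> P_pos t_ge0 i_lt_n; have [U U_unitary PE] := posdef_spectral_eigs P_pos.
have eigs_gt0 (j : 'I_n) : 0 < (eigs P)`_j by apply: nth_eigs_gt0.
rewrite {1}PE (hpow_conj_rdiag_mx _ U_unitary eigs_gt0).
rewrite (eigs_conj_rdiag_mx_sorted (unitarymx_unit U_unitary)) => [|j l jl].
  exact: (nth_mktuple _ _ (Ordinal i_lt_n)).
by apply: ge0_ler_powR; rewrite ?nnegrE ?nth_eigs_ge0 ?nth_eigs_antitone.
Qed.

End Eigenvalues.

HB.lock Definition eigprod (R : realType) k n (X : 'M[R[i]]_n) : R :=
  \prod_(j < k) (eigs X)`_j.

(* The logarithm of the product of the [k] largest singular values of [X]. *)
HB.lock Definition logsv (R : realType) k n (X : 'M[R[i]]_n) : R :=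
  ln (eigprod k (X *m X ^t*)) / 2.

Section SingularValues.
Variables (R : realType) (k n : nat).
Hypothesis k_le_n : (k <= n)%N.
Implicit Types (A P S X Y Z : 'M[R[i]]_n) (V : 'M[R[i]]_(k, n)) (t x y : R).

Lemma eigprod_gt0 P : posdef P -> 0 < eigprod k P.
Proof.
move=> P_pos; rewrite eigprod.unlock; apply: prodr_gt0 => j _.
by apply: nth_eigs_gt0 => //; apply: leq_trans k_le_n.
Qed.

Lemma ln_eigprod_hpow P t : posdef P -> 0 <= t ->
  ln (eigprod k (hpow P t)) = t * ln (eigprod k P).
Proof.
move=> P_pos t_ge0; have Pt_pos := posdef_hpow t P_pos.
have j_lt_n (j : 'I_k) : (j < n)%N := leq_trans (ltn_ord j) k_le_n.
have ln_eigprod (Q : 'M[R[i]]_n) :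
    posdef Q -> ln (eigprod k Q) = \sum_(j < k) ln (eigs Q)`_j.
  by move=> Q_pos; rewrite eigprod.unlock; apply: ln_prod => j; apply: nth_eigs_gt0.
rewrite !ln_eigprod // mulr_sumr.
by apply: eq_bigr => j _; rewrite -ln_powR; congr ln; apply: nth_eigs_hpow.
Qed.

Lemma det_compress_le V P : posdef P ->
  \det (V *m P *m V ^t*) <= (eigprod k P)%:C%C * \det (V *m V ^t*).
Proof.
move=> P_pos; have [U U_unitary PE] := posdef_spectral_eigs P_pos.
set e := fun _ => _ in PE; pose W := V *m U ^t*.
have VE : V = W *m U by rewrite /W mulmxKtV.
have -> : V *m P *m V ^t* = W *m rdiag_mx e *m W ^t*.
  rewrite {1}PE /conj_rdiag_mx invmx_unitary // /W trmxC_mul trmxCK.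
  by rewrite !mulmxA.
have -> : V *m V ^t* = W *m W ^t* by rewrite VE trmxC_mul !mulmxA mulmxtVK.
apply: det_compress_diag_le => f f_inj.
have -> : \prod_i (\row_j (e j)%:C%C) 0 (f i) = (\prod_i e (f i))%:C%C.
  by rewrite rmorph_prod; apply: eq_bigr => i _; rewrite mxE.
rewrite lecR eigprod.unlock.
apply: (@ler_prod_inj_antitone R k (nth 0 (eigs P)) (fun i => f i)).
- by move=> i; apply: nth_eigs_ge0.
- exact: nth_eigs_antitone.
- by move=> i j /val_inj/f_inj.
Qed.

Lemma top_eigenvectors P : posdef P ->
  exists2 V, V \is unitarymx & V *m P = rdiag_mx (fun j : 'I_k => (eigs P)`_j) *m V.
Proof.
move=> P_pos; have [U U_unitary PE] := posdef_spectral_eigs P_pos.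
have widen_inj : injective (widen_ord k_le_n) by move=> i j [] /val_inj.
exists (rowsub (widen_ord k_le_n) U); first exact: rowsub_unitary.
have UP : U *m P = rdiag_mx (fun i : 'I_n => (eigs P)`_i) *m U.
  by rewrite {1}PE /conj_rdiag_mx !mulmxA mulmxV ?mul1mx ?unitarymx_unit.
rewrite mul_rowsub_mx UP; apply/matrixP => i j.
by rewrite mxE /rdiag_mx !mul_diag_mx !mxE.
Qed.

Lemma det_rdiag_top_eigs P :
  \det (rdiag_mx (fun j : 'I_k => (eigs P)`_j)) = (eigprod k P)%:C%C.
Proof. by rewrite det_rdiag_mx eigprod.unlock. Qed.

Lemma ln_eigprod_gram X : ln (eigprod k (X *m X ^t*)) = 2 * logsv k X.
Proof. by rewrite logsv.unlock; field. Qed.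

Lemma logsv_trmxC X : X \in unitmx -> logsv k (X ^t*) = logsv k X.
Proof.
by move=> X_unit; rewrite logsv.unlock eigprod.unlock trmxCK eigs_mulC ?trmxC_unit.
Qed.

Lemma ln_eigprod_gramC X : X \in unitmx ->
  ln (eigprod k (X ^t* *m X)) = 2 * logsv k X.
Proof. by move=> X_unit; rewrite -logsv_trmxC // -ln_eigprod_gram trmxCK. Qed.

Lemma eigprod_gram_mulmx_le X Y : X \in unitmx -> Y \in unitmx ->
  eigprod k ((X *m Y) *m (X *m Y) ^t*) <= eigprod k (X *m X ^t*) * eigprod k (Y *m Y ^t*).
Proof.
move=> X_unit Y_unit; have XY_unit : X *m Y \in unitmx by rewrite unitmx_mul X_unit.
have XX_pos := posdef_gram_unit X_unit.
have YY_pos := posdef_gram_unit Y_unit.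
have [V V_unitary VP] := top_eigenvectors (posdef_gram_unit XY_unit).
have detE : (eigprod k ((X *m Y) *m (X *m Y) ^t*))%:C%C =
    \det ((V *m X) *m (Y *m Y ^t*) *m (V *m X) ^t*).
  rewrite -det_rdiag_top_eigs -[rdiag_mx _](mulmxtVK _ V_unitary) -VP.
  by rewrite !trmxC_mul !mulmxA.
rewrite -lecR rmorphM mulrC [leLHS]detE.
apply: le_trans (det_compress_le _ YY_pos) _.
apply: ler_wpM2l; first by rewrite ler0c ltW // (eigprod_gt0 YY_pos).
rewrite trmxC_mul !mulmxA -[V *m X *m _]mulmxA.
apply: le_trans (det_compress_le _ XX_pos) _.
by rewrite (unitarymxP V_unitary) det1 mulr1.
Qed.

Lemma logsv_mulmx X Y : X \in unitmx -> Y \in unitmx ->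
  logsv k (X *m Y) <= logsv k X + logsv k Y.
Proof.
move=> X_unit Y_unit; have XY_unit : X *m Y \in unitmx by rewrite unitmx_mul X_unit.
have gram_gt0 (Z : 'M[R[i]]_n) : Z \in unitmx -> 0 < eigprod k (Z *m Z ^t*).
  by move=> /posdef_gram_unit/eigprod_gt0.
have := eigprod_gram_mulmx_le X_unit Y_unit.
rewrite -ler_ln ?posrE ?mulr_gt0 ?gram_gt0 // lnM ?posrE ?gram_gt0 //.
by rewrite !ln_eigprod_gram; lra.
Qed.

(* Weyl: the row space of the top eigenvectors of [X] is [X]-invariant, so compressing
   [X X^*] to it has determinant the square of the product of the top eigenvalues. *)
Lemma eigprod_sqr_le_gram P X Z : posdef P -> Z \in unitmx -> X = Z *m P *m invmx Z ->
  eigprod k P ^+ 2 <= eigprod k (X *m X ^t*).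
Proof.
move=> P_pos Z_unit XE.
have Zi_unit : invmx Z \in unitmx by rewrite unitmx_inv.
have X_unit : X \in unitmx.
  by rewrite XE !unitmx_mul Z_unit Zi_unit (posdef_unit P_pos).
have [V V_unitary VP] := top_eigenvectors P_pos.
set D := rdiag_mx _ in VP; pose W := V *m invmx Z.
have WX : W *m X = D *m W by rewrite XE /W !mulmxA (mulmxKV Z_unit) VP.
have W_free : row_free W.
  by rewrite /row_free mxrankMfree ?row_free_unit // mxrank_unitary.
have compressE : W *m (X *m X ^t*) *m W ^t* = D *m (W *m W ^t*) *m D.
  rewrite !mulmxA WX -!mulmxA -trmxC_mul WX trmxC_mul trmxC_rdiag_mx.
  by rewrite !mulmxA.
have := det_compress_le W (posdef_gram_unit X_unit).
rewrite compressE 2!det_mulmx /D det_rdiag_top_eigs (det_posdef (posdef_gram W_free)).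
by rewrite -!rmorphM lecR mulrAC -expr2 ler_pM2r ?expR_gt0.
Qed.

Lemma ln_eigprod_le_logsv P X Z : posdef P -> X \in unitmx -> Z \in unitmx ->
  X = Z *m P *m invmx Z -> ln (eigprod k P) <= logsv k X.
Proof.
move=> P_pos X_unit Z_unit XE; have := eigprod_sqr_le_gram P_pos Z_unit XE.
have P_gt0 := eigprod_gt0 P_pos; have XX_gt0 := eigprod_gt0 (posdef_gram_unit X_unit).
by rewrite -ler_ln ?posrE ?exprn_gt0 // lnXn // ln_eigprod_gram mulr2n; lra.
Qed.

Section Sandwich.
Variables X Y S : 'M[R[i]]_n.
Hypotheses (X_pos : posdef X) (Y_pos : posdef Y) (S_unit : S \in unitmx).

Definition hpow_sandwich x : 'M[R[i]]_n := hpow X x *m S *m hpow Y x.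

Lemma hpow_sandwich0 : hpow_sandwich 0 = S.
Proof. by rewrite /hpow_sandwich !hpow0 // mul1mx mulmx1. Qed.

Lemma hpow_sandwich1 : hpow_sandwich 1 = X *m S *m Y.
Proof. by rewrite /hpow_sandwich !hpow1. Qed.

Lemma unitmx_hpow_sandwich x : hpow_sandwich x \in unitmx.
Proof. by rewrite /hpow_sandwich !unitmx_mul S_unit !unitmx_hpow. Qed.

Lemma hpow_sandwich_midpoint x y (z := (x + y) / 2) :
  hpow_sandwich x *m (hpow_sandwich y) ^t* =
  hpow X (x - z) *m (hpow_sandwich z *m (hpow_sandwich z) ^t*) *m invmx (hpow X (x - z)).
Proof.
rewrite /hpow_sandwich !trmxC_mul !trmxC_hpow // -hpowN // opprB !mulmxA.
rewrite -hpowD // subrK -[in RHS](mulmxA _ (hpow X z)) -hpowD //.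
rewrite -(mulmxA _ (hpow Y x)) -hpowD // -(mulmxA _ (hpow Y z) (hpow Y z)) -hpowD //.
have -> : z + z = x + y by rewrite /z; field.
by have -> : z + (z - x) = y by rewrite /z; field.
Qed.

Lemma logsv_hpow_sandwich_midpoint x y :
  logsv k (hpow_sandwich ((x + y) / 2)) <=
  (logsv k (hpow_sandwich x) + logsv k (hpow_sandwich y)) / 2.
Proof.
have Ty_unit : (hpow_sandwich y) ^t* \in unitmx by rewrite trmxC_unit unitmx_hpow_sandwich.
have Txy_unit : hpow_sandwich x *m (hpow_sandwich y) ^t* \in unitmx.
  by rewrite unitmx_mul unitmx_hpow_sandwich.
have Tz_gram_pos := posdef_gram_unit (unitmx_hpow_sandwich ((x + y) / 2)).
have := ln_eigprod_le_logsv Tz_gram_pos Txy_unit (unitmx_hpow _ X_pos)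
  (hpow_sandwich_midpoint x y).
have := logsv_mulmx (unitmx_hpow_sandwich x) Ty_unit.
by rewrite ln_eigprod_gram logsv_trmxC ?unitmx_hpow_sandwich //; lra.
Qed.

End Sandwich.

Lemma logsv_posdef P : posdef P -> logsv k P = ln (eigprod k P).
Proof.
move=> P_pos; rewrite logsv.unlock posdef_trmxC //.
have -> : P *m P = hpow P (1 + 1) by rewrite hpowD // hpow1.
by rewrite ln_eigprod_hpow ?addr_ge0 //; field.
Qed.

Lemma logsv_hpow P t : posdef P -> 0 <= t -> logsv k (hpow P t) = t * logsv k P.
Proof.
by move=> P_pos t_ge0; rewrite !logsv_posdef ?ln_eigprod_hpow //; exact: posdef_hpow.
Qed.

Lemma logsv_hpow_sandwich_bounded X Y S x : posdef X -> posdef Y -> S \in unitmx ->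
    0 <= x <= 1 ->
  logsv k (hpow_sandwich X Y S x) <= `|logsv k X| + logsv k S + `|logsv k Y|.
Proof.
move=> X_pos Y_pos S_unit /andP[x_ge0 x_le1].
have le_norm (r : R) : x * r <= `|r|.
  by apply: le_trans (ler_norm _) _; rewrite normrM ger0_norm // ler_piMl.
have XxS_unit : hpow X x *m S \in unitmx by rewrite unitmx_mul unitmx_hpow.
apply: le_trans (logsv_mulmx XxS_unit (unitmx_hpow x Y_pos)) _.
rewrite lerD //; last by rewrite logsv_hpow // le_norm.
apply: le_trans (logsv_mulmx (unitmx_hpow x X_pos) S_unit) _.
by rewrite lerD2r logsv_hpow // le_norm.
Qed.

Lemma logsv_interpolation X Y S x : posdef X -> posdef Y -> S \in unitmx ->
    0 <= x <= 1 ->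
  logsv k (hpow X x *m S *m hpow Y x) <=
  (1 - x) * logsv k S + x * logsv k (X *m S *m Y).
Proof.
move=> X_pos Y_pos S_unit xI.
have := midpoint_convex_le_chord ler01
  (fun u v _ _ => logsv_hpow_sandwich_midpoint X_pos Y_pos S_unit u v)
  (fun u => logsv_hpow_sandwich_bounded X_pos Y_pos S_unit) xI.
by rewrite mulr0 add0r mulr1 hpow_sandwich0 // hpow_sandwich1.
Qed.

Lemma logsv_Cordes X Y x : posdef X -> posdef Y -> 0 <= x <= 1 ->
  logsv k (hpow X x *m hpow Y x) <= x * logsv k (X *m Y).
Proof.
move=> X_pos Y_pos xI; have one_pos := posdef1 R n.
have logsv1 : logsv k (1%:M : 'M[R[i]]_n) = 0.
  by rewrite -(hpow0 one_pos) logsv_hpow // mul0r.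
have := logsv_interpolation X_pos Y_pos (unitmx1 _ n) xI.
by rewrite !mulmx1 logsv1 mulr0 add0r.
Qed.

(* [x |-> logsv (A^x S A^-x)] is convex and, [S] being Hermitian, even, hence
   nondecreasing for [x >= 0]. *)
Lemma logsv_conj_hpow_le A S x : posdef A -> posdef S -> 0 <= x <= 1 ->
  logsv k (hpow A x *m S *m hpow A (- x)) <= logsv k (A *m S *m invmx A).
Proof.
move=> A_pos S_pos xI; pose y := (1 - x) / 2.
have yI : 0 <= y <= 1 by rewrite /y; lra.
have -> : A *m S *m invmx A = hpow A 1 *m S *m hpow A (- 1) by rewrite hpowN1 // hpow1.
set T := hpow A 1 *m S *m hpow A (- 1).
have T_unit : T \in unitmx by rewrite !unitmx_mul !unitmx_hpow ?posdef_unit.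
have := logsv_interpolation (posdef_hpow (- 2) A_pos) (posdef_hpow 2 A_pos) T_unit yI.
rewrite -!hpowM // !mul_hpow_sandwich //.
have -> : - 2 * y + 1 = x by rewrite /y; field.
have -> : - 1 + 2 * y = - x by rewrite /y; field.
have -> : - 2 + 1 = - 1 :> R by ring.
have -> : - 1 + 2 = 1 :> R by ring.
have -> : hpow A (- 1) *m S *m hpow A 1 = T ^t*.
  by rewrite !trmxC_mul !trmxC_hpow // posdef_trmxC // mulmxA.
by rewrite logsv_trmxC //; lra.
Qed.

Lemma logsv_mul_le_shift A H (q r : R) : posdef A -> posdef H -> 0 <= q -> 0 < r ->
  logsv k (hpow A q *m H) <= logsv k (hpow A (q + r) *m H *m hpow A (- r)).
Proof.
move=> A_pos H_pos q_ge0 r_gt0; pose v := q / 2; pose u := v + r.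
have u_gt0 : 0 < u by rewrite /u /v; lra.
have S_pos : posdef (hpow A v *m H *m hpow A v).
  by apply: posdef_sandwich H_pos; apply: posdef_hpow.
have xI : 0 <= v / u <= 1.
  by rewrite divr_ge0 ?ler_pdivrMr ?mul1r /u /v //; lra.
have := logsv_conj_hpow_le (posdef_hpow u A_pos) S_pos xI.
rewrite -hpowN // -!hpowM // !mul_hpow_sandwich // mulrN.
have -> : u * (v / u) = v by rewrite mulrC divfK ?gt_eqF.
have -> : v + v = q by rewrite /v; field.
have -> : u + v = q + r by rewrite /u /v; field.
have -> : v - u = - r by rewrite /u; ring.
by rewrite subrr hpow0 // mulmx1.
Qed.

Lemma eq_logsv_mulmx X Y Z : Y *m Y ^t* = Z *m Z ^t* ->
  logsv k (X *m Y) = logsv k (X *m Z).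
Proof.
by move=> eqYZ; rewrite logsv.unlock !trmxC_mul !mulmxA -!(mulmxA X) eqYZ.
Qed.

End SingularValues.

Lemma logmaj_posdef (R : realType) n (P Q : 'M[R[i]]_n) : posdef P -> posdef Q ->
    (forall k, (k <= n)%N -> ln (eigprod k P) <= ln (eigprod k Q)) ->
    logdet P = logdet Q ->
  logmaj P Q.
Proof.
move=> P_pos Q_pos le_eigprod eq_logdet; split; last by rewrite !det_posdef // eq_logdet.
move=> k /andP[_ k_le]; have k_le_n : (k <= n)%N by apply: leq_trans k_le (leq_subr 1 n).
have P_gt0 := eigprod_gt0 k_le_n P_pos; have Q_gt0 := eigprod_gt0 k_le_n Q_pos.
suff : eigprod k P <= eigprod k Q by rewrite eigprod.unlock.
by rewrite -ler_ln ?posrE ?P_gt0 ?Q_gt0 ?le_eigprod.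
Qed.

Section Riccati.
Variables (R : realType) (n : nat).
Implicit Types (A B G : 'M[R[i]]_n) (t : R).

Lemma gmeanE A B : gmean A B =
  hpow A (1/2) *m hpow (hpow A (- (1/2)) *m B *m hpow A (- (1/2))) (1/2) *m hpow A (1/2).
Proof. by rewrite !hpowE. Qed.

Lemma posdef_gmean A B : posdef A -> posdef B -> posdef (gmean A B).
Proof.
move=> A_pos B_pos; rewrite gmeanE.
have M_pos := posdef_sandwich (posdef_hpow (- (1/2)) A_pos) B_pos.
exact: posdef_sandwich (posdef_hpow _ A_pos) (posdef_hpow _ M_pos).
Qed.

Lemma gmean_Riccati A B : posdef A -> posdef B ->
  gmean A B *m invmx A *m gmean A B = B.
Proof.
move=> A_pos B_pos; rewrite gmeanE.
have := posdef_sandwich (posdef_hpow (- (1/2)) A_pos) B_pos.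
set M := _ *m B *m _ => M_pos; set a := hpow A (1/2); set m := hpow M (1/2).
have aAa : a *m invmx A *m a = 1%:M.
  rewrite -hpowN1 // -!hpowD //.
  by have -> : 1/2 + - 1 + 1/2 = 0 :> R by [field]; rewrite hpow0.
transitivity (a *m (m *m (a *m invmx A *m a) *m m) *m a); first by rewrite !mulmxA.
rewrite aAa mulmx1 hpow_half_sqr // mul_hpow_sandwich //.
by rewrite subrr addNr hpow0 // mul1mx mulmx1.
Qed.

Lemma logsv_Riccati_le k A B G t : (k <= n)%N -> posdef A -> posdef B -> posdef G ->
    G *m A *m G = B -> -1 <= t <= - (1/2) ->
  logsv k (hpow A (1/2) *m hpow G t) <= logsv k (hpow A (1 - t) *m hpow B t) / 2.
Proof.
move=> k_le_n A_pos B_pos G_pos GAG /andP[t_ge t_le].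
have t_neq0 : t != 0 by apply/eqP; lra.
pose q := - (1 / (2 * t)).
have qI : 0 <= q <= 1.
  rewrite /q; have -> : - (1 / (2 * t)) = 1 / (2 * - t) by field.
  by rewrite divr_ge0 ?ler_pdivrMr ?mul1r //; lra.
have tI : 0 <= - t <= 1 by lra.
have Gi_pos := posdef_invmx G_pos.
have pow_t : logsv k (hpow A (1/2) *m hpow G t) <= - t * logsv k (hpow A q *m invmx G).
  have := logsv_Cordes k_le_n (posdef_hpow q A_pos) Gi_pos tI.
  rewrite -hpowN1 // -!hpowM //.
  have -> : q * - t = 1/2 by rewrite /q; field.
  by have -> : - 1 * - t = t by ring.
have shift : logsv k (hpow A q *m invmx G) <=
    logsv k (hpow A (q + 1/2) *m invmx G *m hpow A (- (1/2))).
  by case/andP: qI => q_ge0 _; apply: logsv_mul_le_shift => //; lra.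
have Riccati : logsv k (hpow A (q + 1/2) *m invmx G *m hpow A (- (1/2))) =
    logsv k (hpow A (q + 1/2) *m hpow B (- (1/2))).
  rewrite -mulmxA; apply: eq_logsv_mulmx.
  rewrite !trmxC_mul !trmxC_hpow // (posdef_trmxC Gi_pos) !mulmxA -(mulmxA (invmx G)).
  rewrite -!hpowD // (_ : - (1/2) + - (1/2) = - 1); last by field.
  by rewrite !hpowN1 // -GAG !invmx_mulmx ?unitmx_mul ?posdef_unit // mulmxA.
have pow_q : logsv k (hpow A (q + 1/2) *m hpow B (- (1/2))) <=
    q * logsv k (hpow A (1 - t) *m hpow B t).
  have := logsv_Cordes k_le_n (posdef_hpow (1 - t) A_pos) (posdef_hpow t B_pos) qI.
  rewrite -!hpowM //.
  have -> : (1 - t) * q = q + 1/2 by rewrite /q; field.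
  by have -> : t * q = - (1/2) by rewrite /q; field.
apply: le_trans pow_t _; rewrite Riccati in shift.
have -> : logsv k (hpow A (1 - t) *m hpow B t) / 2 =
    - t * (q * logsv k (hpow A (1 - t) *m hpow B t)) by rewrite /q; field.
by apply: ler_wpM2l; [lra | exact: le_trans pow_q].
Qed.

Lemma ln_eigprod_Riccati_le k A B G t : (k <= n)%N ->
    posdef A -> posdef B -> posdef G -> G *m A *m G = B -> -1 <= t <= - (1/2) ->
  ln (eigprod k (hpow G t *m A *m hpow G t)) <=
  ln (eigprod k (hpow (hpow A (1 - t) *m hpow B (2 * t) *m hpow A (1 - t)) (1/2))).
Proof.
move=> k_le_n A_pos B_pos G_pos GAG tI.
have Q_pos := posdef_sandwich (posdef_hpow (1 - t) A_pos) (posdef_hpow (2 * t) B_pos).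
have X_unit : hpow A (1/2) *m hpow G t \in unitmx by rewrite unitmx_mul !unitmx_hpow.
have -> : hpow G t *m A *m hpow G t =
    (hpow A (1/2) *m hpow G t) ^t* *m (hpow A (1/2) *m hpow G t).
  by rewrite trmxC_mul !trmxC_hpow // -{1}(hpow_half_sqr A_pos) !mulmxA.
rewrite ln_eigprod_hpow ?divr_ge0 //.
have -> : hpow A (1 - t) *m hpow B (2 * t) *m hpow A (1 - t) =
    (hpow A (1 - t) *m hpow B t) *m (hpow A (1 - t) *m hpow B t) ^t*.
  rewrite trmxC_mul !trmxC_hpow // !mulmxA -(mulmxA _ (hpow B t) (hpow B t)) -hpowD //.
  by have -> : t + t = 2 * t by ring.
rewrite ln_eigprod_gramC // ln_eigprod_gram.
by have := logsv_Riccati_le k_le_n A_pos B_pos G_pos GAG tI; lra.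
Qed.

Lemma logdet_Riccati A B G t : posdef A -> posdef B -> posdef G -> G *m A *m G = B ->
  logdet (hpow G t *m A *m hpow G t) =
  logdet (hpow (hpow A (1 - t) *m hpow B (2 * t) *m hpow A (1 - t)) (1/2)).
Proof.
move=> A_pos B_pos G_pos GAG; have A_unit := posdef_unit A_pos.
have B_unit := posdef_unit B_pos; have G_unit := posdef_unit G_pos.
have Q_pos := posdef_sandwich (posdef_hpow (1 - t) A_pos) (posdef_hpow (2 * t) B_pos).
rewrite logdet_hpow // !logdetM ?unitmx_mul ?unitmx_hpow ?A_unit //.
rewrite !logdet_hpow // -GAG !logdetM ?unitmx_mul ?G_unit //.
by field.
Qed.

End Riccati.

Theorem theorem4p7 (R : realType) (n : nat) (A B : 'M[R[i]]_n) (t : R) :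
  posdef A -> posdef B -> -1 <= t <= -(1/2) ->
  logmaj (spt A B t)
         (mxpow (mxpow A (1 - t) *m mxpow B (2 * t) *m mxpow A (1 - t)) (1/2)).
Proof.
move=> A_pos B_pos tI; have Ai_pos := posdef_invmx A_pos.
have G_pos := posdef_gmean Ai_pos B_pos; have GAG := gmean_Riccati Ai_pos B_pos.
rewrite invmxK in GAG; rewrite /spt.
move: (gmean _ B) G_pos GAG => G G_pos GAG; rewrite -!hpowE.
have P_pos := posdef_sandwich (posdef_hpow t G_pos) A_pos.
have Q_pos := posdef_sandwich (posdef_hpow (1 - t) A_pos) (posdef_hpow (2 * t) B_pos).
apply: (logmaj_posdef P_pos (posdef_hpow _ Q_pos)); last exact: logdet_Riccati.
by move=> k k_le_n; apply: ln_eigprod_Riccati_le.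
Qed.
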